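(* Let $p$ be a prime, let $g\in\mathbb{F}_p^*$ have multiplicative order $t$, and let $N$ be a positive integer with $N\le t$. Let $S_{g,p}(\lambda,N)=\sum_{n=1}^{N}e^{2\pi i\lambda g^n/p}$. Then, as $N\to\infty$, $$\max_{\gcd(\lambda,p)=1}|S_{g,p}(\lambda,N)|\le\begin{cases}p^{1/8}N^{71/96+o(1)}, & N\le t^{1/2},\\ p^{1/8}t^{-1/96}N^{73/96+o(1)}, & t^{1/2}<N\le p^{1/2},\\ p^{1/4}t^{-1/96}N^{49/96+o(1)}, & p^{1/2}<N<t.\end{cases}$$
   Context: $\mathbb{F}_p$ is the field of $p$ elements, identified with residues modulo $p$, so $e^{2\pi i z/p}$ is well defined for $z\in\mathbb{F}_p$. The maximum is over integers $\lambda$ coprime to $p$. The quantity $o(1)$ tends to $0$ as $N\to\infty$, uniformly in all other parameters. That is, for every $\varepsilon>0$ there is $N_0(\varepsilon)$, depending only on $\varepsilon$, such that for all such $p,g,t,N$ with $N\ge N_0(\varepsilon)$ the bounds hold with $o(1)$ replaced by $\varepsilon$. *)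

(* Defs.v *)
From mathcomp Require Import all_boot all_order all_algebra all_fingroup.
From mathcomp Require Import all_classical all_reals all_analysis.
From mathcomp Require Import complex.

Set Implicit Arguments.
Unset Strict Implicit.
Unset Printing Implicit Defensive.

Import Order.TTheory GRing.Theory Num.Theory.
Local Open Scope ring_scope.

(* exp(i x) for real x, by Euler's formula. *)
Definition expi (R : realType) (x : R) : R[i] := (cos x +i* sin x)%C.

(* exp(2 pi i z / p). The residue z is used through its representative in
   {0, ..., p - 1}; for p prime this is the standard additive character of F_p. *)
Definition ep (R : realType) (p : nat) (z : 'F_p) : R[i] :=
  expi (2 * pi * (z : nat)%:R / p%:R).

Definition expsum (R : realType) (p : nat) (g : {unit 'F_p}) (lambda : int)
    (N : nat) : R[i] :=
  \sum_(1 <= n < N.+1) ep R (lambda%:~R * val g ^+ n).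

(* Main.v *)
Require Import Defs.
From mathcomp Require Import all_boot all_order all_algebra all_fingroup.
From mathcomp Require Import all_solvable all_field zify ring lra.
From mathcomp Require Import all_classical all_reals all_analysis.
From mathcomp Require Import complex.

Set Implicit Arguments.
Unset Strict Implicit.
Unset Printing Implicit Defensive.

Import Order.TTheory GRing.Theory Num.Theory.
Local Open Scope ring_scope.

(** The elements [g ^ n], [1 <= n <= N], form a set [A] with [|A A| <= 2 |A|], and this
    small doubling forces a small additive energy [E]. By a Balog-Szemeredi-Gowers argument there
    is a large subset [A'] of [A] all of whose differences have many representations
    [x1 - x2 - (x3 - x4)] in [A]; hence [W = (A' - A') A] is small, because each of its elements has
    as many representations in [A A]. Every quotient of two differences of [A'] arises from [|A|]
    pairs in [W x W], while Redei's polynomial method (lacunary polynomials modulo [p]) shows that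
    these quotients number more than [n (n - 1)] as soon as [n = |A'|] satisfies [n ^ 2 <= p].
    Comparing the two counts gives [E ^ 8 << N ^ 23] or [p E ^ 6 << N ^ 19].

    The moments of the exponential sum over the translates [l * x], [x] in [A], are bounded by [p]
    and [E]. Since [S (l g ^ k)] differs from [S l] by two sums of length [k], an induction on [N]
    shows that all translates with [k <= N / 16] are about as large as the sum itself, so the
    moment bounds turn into the pointwise bounds [S ^ 96 << p ^ 12 N ^ 71] for [N ^ 2 <= p] and
    [S ^ 96 << p ^ 23 N ^ 49] in general. The absolute constants are absorbed by [N ^ eps]. *)

(** * Quotients of differences and Redei's polynomial *)

(* Total degree at most m, for a polynomial in two variables with 'X the outer one. *)
Definition tdeg_le (F : fieldType) (m : nat) (P : {poly {poly F}}) : Prop :=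
  forall i, (size (P`_i)%R <= m.+1 - i)%N.

Lemma tdeg_leB (F : fieldType) m (P Q : {poly {poly F}}) :
  tdeg_le m P -> tdeg_le m Q -> tdeg_le m (P - Q).
Proof.
move=> hP hQ i; rewrite coefB (leq_trans (size_polyD _ _)) // size_polyN.
by rewrite geq_max hP hQ.
Qed.

Lemma tdeg_leM (F : fieldType) m1 m2 (P Q : {poly {poly F}}) :
  tdeg_le m1 P -> tdeg_le m2 Q -> tdeg_le (m1 + m2) (P * Q).
Proof.
move=> hP hQ i; rewrite coefM (leq_trans (size_sum _ _ _)) //.
apply/bigmax_leqP => j _.
(* A nonzero coefficient keeps the truncated subtraction in its size bound positive, so that the two
   bounds add up; zero coefficients are treated apart. *)
have [->|P0] := eqVneq P`_j 0; first by rewrite mul0r size_poly0.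
have [->|Q0] := eqVneq Q`_(i - j) 0; first by rewrite mulr0 size_poly0.
rewrite size_mul //; have := hP j; have := hQ (i - j)%N; have := ltn_ord j.
move: P0 Q0; rewrite -!size_poly_gt0.
set a := size (polyseq P`_j); set b := size (polyseq Q`_(i - j)); lia.
Qed.

Lemma tdeg_leMX (F : fieldType) m (P : {poly {poly F}}) :
  tdeg_le m P -> tdeg_le m.+1 (P * 'X).
Proof.
move=> hP i; rewrite coefMX; case: i => [|i] /=; first by rewrite size_poly0.
by have := hP i; rewrite subSS.
Qed.

Lemma tdeg_leC (F : fieldType) m (c : {poly F}) :
  (size c <= m.+1)%N -> tdeg_le m (c%:P).
Proof.
by move=> hc i; rewrite coefC; case: i => [|i] /=; rewrite ?subn0 ?size_poly0.
Qed.

Lemma tdeg_le_prod (F : fieldType) (s : seq {poly {poly F}}) :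
  (forall P, P \in s -> tdeg_le 1 P) -> tdeg_le (size s) (\prod_(P <- s) P).
Proof.
elim: s => [|P s IHs] hs.
  by rewrite big_nil; apply: tdeg_leC; rewrite size_poly1.
rewrite big_cons -[size _]/(1 + size s)%N; apply: tdeg_leM.
  by apply: hs; rewrite mem_head.
by apply: IHs => Q Qs; apply: hs; rewrite in_cons Qs orbT.
Qed.

(** Long division, one power at a time: [r * 'X] is corrected by [P] times its coefficient of degree
    [d], and this keeps the total degree at most [k.+1]. *)
Lemma divXn_tdeg (F : fieldType) d (P : {poly {poly F}}) k :
  P \is monic -> size P = d.+1 -> (0 < d)%N -> tdeg_le d P ->
  exists q r, [/\ 'X^k = q * P + r, (size r <= d)%N & tdeg_le k r].
Proof.
move=> Pmon sP d0 hP; elim: k => [|k [q [r [e sr hr]]]].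
  exists 0, 1; split; first by rewrite mul0r add0r.
    by rewrite size_poly1.
  by apply: tdeg_leC; rewrite size_poly1.
have hc : (size (r`_d.-1)%R <= k.+1 - d.-1)%N by apply: hr.
exists (q * 'X + (r`_d.-1)%:P), (r * 'X - (r`_d.-1)%:P * P); split.
- by rewrite exprSr e; ring.
- apply/leq_sizeP => i; rewrite leq_eqVlt => /predU1P[<-|di].
    rewrite coefB coefMX coefCM (gtn_eqF d0).
    have -> : P`_d = 1 by move/monicP: Pmon; rewrite lead_coefE sP.
    by rewrite mulr1 subrr.
  rewrite coefB coefMX coefCM gtn_eqF ?(leq_ltn_trans _ di) //.
  rewrite [r`_i.-1]nth_default ?[P`_i]nth_default ?mulr0 ?subr0 ?sP //.
  by apply: leq_trans sr _; lia.
- have [->|c0] := eqVneq (r`_d.-1) 0; first by rewrite mul0r subr0; apply: tdeg_leMX.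
  apply: tdeg_leB; first exact: tdeg_leMX.
  (* A nonzero coefficient forces [d <= k.+1], so this subtraction is exact. *)
  have -> : k.+1 = ((k.+1 - d) + d)%N.
    by rewrite subnK //; move: c0 hc; rewrite -size_poly_gt0; lia.
  apply: tdeg_leM => //; apply: tdeg_leC; apply: leq_trans hc _; lia.
Qed.

Definition quotient_set (F : finFieldType) (A : {set F}) : {set F} :=
  [set (u.1.1 - u.1.2) / (u.2.1 - u.2.2)
     | u in [set u : (F * F) * (F * F) |
              [&& u.1.1 \in A, u.1.2 \in A, u.2.1 \in A, u.2.2 \in A
                & u.2.1 != u.2.2]]].

Lemma quotient_setP (F : finFieldType) (A : {set F}) y :
  reflect (exists a b c d, [/\ [/\ a \in A, b \in A, c \in A & d \in A], c != d
                             & y = (a - b) / (c - d)])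
          (y \in quotient_set A).
Proof.
apply: (iffP imsetP) => [[[[a b] [c d]]]|[a [b [c [d [[aA bA cA dA] cd ->]]]]]].
  by rewrite inE /= => /and5P[? ? ? ? ?] ->; exists a, b, c, d.
by exists ((a, b), (c, d)); rewrite ?inE //= aA bA cA dA.
Qed.

Lemma quotient_setS (F : finFieldType) (A B : {set F}) :
  A \subset B -> quotient_set A \subset quotient_set B.
Proof.
move=> /fintype.subsetP sAB; apply/fintype.subsetP => y /quotient_setP.
move=> [a [b [c [d [[aA bA cA dA] cd ->]]]]].
by apply/quotient_setP; exists a, b, c, d; rewrite !sAB.
Qed.

(* Redei's polynomial of [A x A] has the linear factors ['X - (b - a y)]. For [y] outside the
   quotient set these are distinct, so the remainder of ['X^p] modulo it specializes to ['X]. *)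
Section Redei.
Variables (p : nat) (A : {set 'F_p}).
Hypothesis p_pr : prime p.

Let s := enum (finset.setX A A).
Lemma exists_distinct_pair : (1 < #|A|)%N -> exists a b, [/\ a \in A, b \in A & b != a].
Proof.
move=> A1; have /set0Pn[a aA] : A != finset.set0 by rewrite -card_gt0 ltnW.
move: A1; rewrite (cardsD1 a) aA ltnS card_gt0 => /set0Pn[b].
by rewrite !inE => /andP[ba bA]; exists a, b.
Qed.

Let Redei : {poly {poly 'F_p}} :=
  \prod_(ab <- s) ('X - (ab.2%:P - ab.1 *: 'X)%:P).

Lemma size_Redei : size Redei = (#|A| * #|A|).+1.
Proof. by rewrite size_prod_XsubC -cardE cardsX. Qed.

Lemma tdeg_Redei : tdeg_le (#|A| * #|A|) Redei.
Proof.
pose factor (ab : 'F_p * 'F_p) : {poly {poly 'F_p}} := 'X - (ab.2%:P - ab.1 *: 'X)%:P.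
have -> : (#|A| * #|A|)%N = size (map factor s).
  by rewrite size_map -cardE cardsX.
have -> : Redei = \prod_(P <- map factor s) P.
  by rewrite big_map.
apply: tdeg_le_prod => P /mapP[[a b] _ ->] /=.
apply: tdeg_leB.
  rewrite -[X in tdeg_le _ X]mul1r; apply: tdeg_leMX.
  by apply: tdeg_leC; rewrite size_poly1.
apply: tdeg_leC; rewrite (leq_trans (size_polyD _ _)) // size_polyN geq_max.
rewrite (leq_trans (size_polyC_leq1 _)) //=.
by rewrite (leq_trans (size_scale_leq _ _)) // size_polyX.
Qed.

Lemma Redei_specialize y :
  map_poly (horner_eval y) Redei = \prod_(ab <- s) ('X - (ab.2 - ab.1 * y)%:P).
Proof.
rewrite rmorph_prod; apply: eq_bigr => -[a b] _ /=.
by rewrite rmorphB /= map_polyX map_polyC /= /horner_eval !hornerE.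
Qed.

Lemma Redei_specialize_dvd y :
  y \notin quotient_set A -> map_poly (horner_eval y) Redei %| 'X^p - 'X.
Proof.
move=> yQ; rewrite Redei_specialize.
rewrite -(big_map (fun ab : 'F_p * 'F_p => ab.2 - ab.1 * y) xpredT
   (fun z => 'X - z%:P)).
apply: uniq_roots_dvdp.
  apply/allP => z _; rewrite rootE !hornerE.
  by have := expf_card z; rewrite card_Fp // => ->; rewrite subrr.
rewrite uniq_rootsE map_inj_in_uniq ?enum_uniq //.
move=> [a b] [a' b']; rewrite !mem_enum !inE /= => /andP[aA bA] /andP[a'A b'A] e.
have [eaa|neaa] := eqVneq a a'.
  by move: e; rewrite eaa => /addIr ->.
(* Equal roots with [a != a'] exhibit [y] as [(b - b') / (a - a')]. *)
case/negP: yQ; apply/quotient_setP; exists b, b', a, a'; split => //.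
have d0 : a - a' != 0 by rewrite subr_eq0.
apply: (mulIf d0); rewrite divfK // mulrC mulrBl.
by move/eqP: e; rewrite subr_eq -addrA addrC -subr_eq => /eqP ->; ring.
Qed.

(** The remainder [r] of ['X^p] has degree at most [#|Q|] in ['X], because its higher coefficients
    have too many roots. At [y = 0] Redei's polynomial is a power [f ^+ n], and differentiating the
    division shows that [f ^+ n.-1] divides the derivative of [r0]. Comparing degrees gives the
    claim unless [r0] is constant, which two distinct elements of [A] exclude. *)
Lemma card_quotient_set_gt : (1 < #|A|)%N -> (#|A| * #|A| <= p)%N ->
  (#|A| * #|A|.-1 < #|quotient_set A|)%N.
Proof.
set n := #|A| => n1 nnp; set Q := quotient_set A.
have nn0 : (0 < n * n)%N by rewrite muln_gt0; lia.
have [q [r [e sr hr]]] := divXn_tdeg p (monic_prod_XsubC _ _ _) size_Redei nn0 tdeg_Redei.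
have chp := pchar_Fp p_pr.
have rE y : y \notin Q -> map_poly (horner_eval y) r = 'X.
  move=> yQ; have := Redei_specialize_dvd yQ; set f := map_poly _.
  have /(congr1 f) := e; rewrite /f rmorphD rmorphM /= map_polyXn -/f => ->.
  rewrite -addrA dvdp_addr ?dvdp_mull //.
  have sE : size (f Redei) = (n * n).+1.
    by rewrite /f Redei_specialize size_prod_XsubC -cardE cardsX.
  (* The difference is a multiple of a polynomial of degree [n * n] but has smaller degree
     itself. *)
  have [/eqP|nz] := eqVneq (f r - 'X) 0; first by rewrite subr_eq0 => /eqP.
  move/(dvdp_leq nz); rewrite sE leqNgt ltnS (leq_trans (size_polyD _ _)) //.
  rewrite size_polyN size_polyX geq_max (leq_trans (size_poly _ _)) //=.
  by apply: leq_trans (leq_mul n1 n1).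
have coefr i : (#|Q| < i)%N -> r`_i = 0.
  move=> Qi; apply/eqP; apply: contraT => ri0.
  have i1 : (1 < i)%N.
    apply: leq_ltn_trans Qi; rewrite card_gt0.
    have [a [b [aA bA ba]]] := exists_distinct_pair n1.
    apply/set0Pn; exists 0; apply/quotient_setP.
    by exists a, a, b, a; rewrite subrr mul0r.
  (* For [i > 1] this coefficient vanishes at the [p - #|Q|] points outside [Q], while its degree is
     at most [p - i]. *)
  have rt : all (root r`_i) (enum (~: Q)).
    apply/allP => y; rewrite mem_enum inE => yQ; rewrite rootE.
    have := rE y yQ => /(congr1 (fun P : {poly 'F_p} => P`_i)).
    by rewrite coef_map /= coefX (gtn_eqF i1) => /eqP.
  have := max_poly_roots ri0 rt (enum_uniq _).
  have := hr i; rewrite -cardE; have := cardsC Q; rewrite card_Fp //.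
  by set a := size (polyseq r`_i); set b := #|~: Q|; lia.
pose r0 := map_poly (horner_eval 0) r.
have sr0 : (size r0 <= #|Q|.+1)%N.
  by apply/leq_sizeP => i iQ; rewrite coef_map /= coefr // /horner_eval horner0.
pose f : {poly 'F_p} := \prod_(b in A) ('X - b%:P).
have RE : map_poly (horner_eval 0) Redei = f ^+ n.
  rewrite Redei_specialize /s big_enum /=.
  rewrite (eq_bigr (fun ab => 'X - ab.2%:P)); last by move=> ab _; rewrite mulr0 subr0.
  rewrite (eq_bigl (fun ab => (ab.1 \in A) && (ab.2 \in A))); last first.
    by move=> ab; rewrite !inE.
  rewrite -(pair_big_dep (mem A) (fun _ b => b \in A) (fun _ b => 'X - b%:P)) /=.
  by rewrite prodr_const.
have e0 : 'X^p = map_poly (horner_eval 0) q * f ^+ n + r0.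
  have /(congr1 (map_poly (horner_eval 0))) := e.
  by rewrite rmorphD rmorphM /= map_polyXn RE.
have fmon : f \is monic by apply: monic_prod => b _; apply: monicXsubC.
have sf : size f = n.+1 by rewrite /f -big_enum size_prod_XsubC -cardE.
have dvd_r0' : f ^+ n.-1 %| r0^`().
  have /(congr1 (@deriv _)) := e0.
  rewrite derivXn mulrn_pchar ?(rmorph_pchar (@polyC _)) // derivD.
  have : f ^+ n.-1 %| (map_poly (horner_eval 0) q * f ^+ n)^`().
    rewrite derivM deriv_exp dvdp_add //.
      by rewrite dvdp_mull // dvdp_exp2l // leq_pred.
    by rewrite dvdp_mull // -mulrnAl dvdp_mull.
  by move=> dvd1 e1; rewrite -(dvdp_addr _ dvd1) -e1 dvdp0.
have [r00|r0n0] := eqVneq r0^`() 0; last first.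
  (* In degrees, [n * n.-1] is at most that of the derivative, which is less than that of [r0],
     hence less than [#|Q|]. *)
  have := dvdp_leq r0n0 dvd_r0'.
  have := lt_size_deriv (p := r0).
  have -> : r0 != 0 by apply: contraNneq r0n0 => ->; rewrite deriv0.
  move=> /(_ isT); have := size_exp f n.-1; rewrite sf /=.
  have : f ^+ n.-1 != 0 by rewrite monic_neq0 // monic_exp.
  rewrite -size_poly_gt0.
  have : (size r0 <= #|Q|.+1)%N by [].
  move: (size _) (size _) (size _) #|Q| => x y z t.
  move: (n * n.-1)%N => c; lia.
(* The degree of [r0] is below [n * n <= p], so every positive exponent in it is invertible modulo
   [p]. *)
have r0i i : r0`_i.+1 = 0.
  have [ip|ip] := ltnP i.+1 p; last first.
    rewrite nth_default //; apply: leq_trans ip; apply: leq_trans nnp.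
    exact: leq_trans (size_poly _ _) sr.
  have /(congr1 (fun P : {poly 'F_p} => P`_i)) := r00.
  rewrite coef_deriv coef0 -mulr_natr => /eqP; rewrite mulf_eq0 => /orP[/eqP //|].
  by rewrite -(dvdn_pcharf chp) gtnNdvd.
have r0C : r0 = (r0`_0)%:P.
  by apply/polyP => -[|i]; rewrite coefC //= r0i.
(* At [a] the polynomial [f] vanishes and [a ^+ p = a]. *)
have rootA a : a \in A -> a = r0`_0.
  move=> aA; have : a ^+ p = a by have := expf_card a; rewrite card_Fp.
  have /(congr1 (fun P : {poly 'F_p} => P.[a])) := e0.
  rewrite /= hornerXn hornerD hornerM horner_exp.
  have -> : r0.[a] = r0`_0 by rewrite {1}r0C hornerC.
  have -> : f.[a] = 0.
    by apply/eqP; rewrite -rootE /f -big_enum root_prod_XsubC mem_enum.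
  by rewrite expr0n gtn_eqF ?(ltnW n1) // mulr0 add0r => -> ->.
have [a [b [aA bA]]] := exists_distinct_pair n1.
by rewrite (rootA a aA) (rootA b bA) eqxx.
Qed.

End Redei.

(** * Additive energy and popular differences *)

Section Energy.
Variables (V : finZmodType) (A : {set V}).

(** Its cardinality counts the representations [v = y - x] with [x], [y] in [A]. *)
Definition shift_meet (v : V) : {set V} := [set x in A | x + v \in A].

(** The number of quadruples in [A] with [x1 - x2 = x3 - x4], sorted by the common difference. *)
Definition energy : nat := (\sum_v #|shift_meet v| ^ 2)%N.

Lemma card_shift_meet v : #|shift_meet v| = (\sum_(x in A) ((x + v)%R \in A))%N.
Proof.
rewrite -sum1_card big_mkcond [RHS]big_mkcond; apply: eq_bigr => x _.
by rewrite inE; case: (x \in A).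
Qed.

Lemma sum_mem_shift (B : {set V}) x : (\sum_v ((x + v)%R \in B) = #|B|)%N.
Proof.
rewrite (reindex_inj (addrI (- x))) /= -sum1_card [RHS]big_mkcond.
by apply: eq_bigr => v _; rewrite addrA subrr add0r; case: (v \in B).
Qed.

Lemma sum_card_shift_meet : (\sum_v #|shift_meet v| = #|A| ^ 2)%N.
Proof.
under eq_bigr do rewrite card_shift_meet.
by rewrite exchange_big /= (eq_bigr (fun=> #|A|)) ?sum_nat_const // => x _; rewrite sum_mem_shift.
Qed.

Lemma card_shift_meet_le v : (#|shift_meet v| <= #|A|)%N.
Proof. by apply/subset_leq_card/fintype.subsetP => x; rewrite inE => /andP[]. Qed.

Lemma energy_le_cube : (energy <= #|A| ^ 3)%N.
Proof.
rewrite expnS -sum_card_shift_meet big_distrr /= leq_sum // => v _.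
by rewrite -mulnn leq_mul ?card_shift_meet_le.
Qed.

Lemma energy_ge_sq : (#|A| ^ 2 <= energy)%N.
Proof.
have -> : #|A| = #|shift_meet 0|.
  by congr #|pred_of_set _|; apply/setP => x; rewrite inE addr0 andbb.
by rewrite /energy (bigD1 0) //= leq_addr.
Qed.

(** The difference has fewer than [E / (32 N^2)] representations; the denominator is cleared to stay
    in [nat]. *)
Definition is_bad (a b : V) : bool := (32 * #|A| ^ 2 * #|shift_meet (b - a)%R| < energy)%N.

Definition bad_pairs v : nat :=
  (\sum_(a in shift_meet v) #|[set b in shift_meet v | is_bad a b]|)%N.

(** A pair [(a, b)] of elements of [A] lies in [shift_meet v] for exactly [#|shift_meet (b - a)|]
    shifts [v], which is small for a bad pair. *)
Lemma sum_bad_pairs : (32 * #|A| ^ 2 * \sum_v bad_pairs v <= #|A| ^ 2 * energy)%N.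
Proof.
have -> : (\sum_v bad_pairs v
           = \sum_(a in A) \sum_(b in A | is_bad a b) #|shift_meet (b - a)%R|)%N.
  transitivity (\sum_v \sum_(a in A) \sum_(b in A | is_bad a b)
     (((a + v)%R \in A) && ((b + v)%R \in A)))%N.
    apply: eq_bigr => v _; rewrite /bad_pairs big_mkcond [RHS]big_mkcond; apply: eq_bigr => a _.
    rewrite inE; case: (a \in A) => //=.
    case: (a + v \in A) => /=; last by rewrite big1.
    rewrite -sum1_card big_mkcond [RHS]big_mkcond; apply: eq_bigr => b _.
    by rewrite !inE; case: (b \in A); case: (b + v \in A); case: (is_bad a b).
  rewrite exchange_big; apply: eq_bigr => a aA.
  rewrite exchange_big; apply: eq_bigr => b bA.
  rewrite (reindex_inj (addrI (- a))) /= card_shift_meet [RHS]big_mkcond.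
  apply: eq_bigr => v _; rewrite addrA subrr add0r.
  have -> : b + (- a + v) = v + (b - a) by rewrite addrA addrC.
  by case: (v \in A).
rewrite big_distrr /= -mulnn -mulnA -[X in (_ <= X)%N]sum_nat_const leq_sum // => a _.
rewrite big_distrr /= -[X in (_ <= X)%N]sum_nat_const.
rewrite [X in (X <= _)%N]big_mkcond [X in (_ <= X)%N]big_mkcond /= leq_sum // => b _.
case: (b \in A) => //=; case: ifP => // /ltnW.
by rewrite -mulnn.
Qed.

Lemma exists_popular_shift : (0 < #|A|)%N ->
  exists v, (16 * bad_pairs v < #|shift_meet v| ^ 2)%N /\
            (energy < 4 * #|A| ^ 2 * #|shift_meet v|)%N.
Proof.
move=> A0; have E0 : (0 < energy)%N by apply: leq_trans energy_ge_sq; rewrite expn_gt0 A0.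
have NE0 : (0 < #|A| ^ 2 * energy)%N by rewrite muln_gt0 expn_gt0 A0.
(* Were this false for all [v], summation would give [4 N^2 E <= 2 N^2 E + N^2 E]. Each of the two
   terms on the left yields one of the claims. *)
suff [v hv] : exists v, (64 * #|A| ^ 2 * bad_pairs v + energy * #|shift_meet v|
                  < 4 * #|A| ^ 2 * #|shift_meet v| ^ 2)%N.
  have N0 : (0 < #|A| ^ 2)%N by rewrite expn_gt0 A0.
  exists v; move: hv N0; set m := #|shift_meet v|; set b := bad_pairs v; set N2 := (_ ^ 2)%N.
  rewrite -(mulnn m); set e := energy => hv N0; split.
    rewrite -(ltn_pmul2l N0); nia.
  have m0 : (0 < m)%N by nia.
  by rewrite -(ltn_pmul2r m0); nia.
apply/existsP; apply: contraT; rewrite negb_exists => /forallP hle.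
have : (\sum_v 4 * #|A| ^ 2 * #|shift_meet v| ^ 2
        <= \sum_v (64 * #|A| ^ 2 * bad_pairs v + energy * #|shift_meet v|))%N.
  by apply: leq_sum => v _; rewrite leqNgt hle.
rewrite -!big_distrr big_split /= -!big_distrr /= -/energy sum_card_shift_meet.
have := sum_bad_pairs; move: NE0; set S := (\sum_v bad_pairs v)%N.
move: energy (#|A| ^ 2)%N S => e N2 S; rewrite !(mulnC N2) -!mulnA !(mulnC N2).
by move: (S * N2)%N (e * N2)%N => x y; lia.
Qed.

End Energy.

(** Fibres over distinct points are disjoint; this is the common form of the double counts below. *)
Lemma sum_card_fibers (T U : finType) (S : {set T}) (f : T -> U) (B : {set U}) :
  (\sum_(w in B) #|[set q in S | f q == w]| <= #|S|)%N.
Proof.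
rewrite -[X in (_ <= X)%N]sum1_card (partition_big f xpredT) //=.
rewrite [X in (X <= _)%N]big_mkcond leq_sum // => w _.
case: (w \in B) => //; rewrite -sum1_card.
by rewrite (eq_bigl (fun q => (q \in S) && (f q == w))) // => q; rewrite inE.
Qed.

Definition difference_reps (V : finZmodType) (A : {set V}) (d : V) : {set (V * V) * (V * V)} :=
  [set u in finset.setX (finset.setX A A) (finset.setX A A)
     | u.1.1 - u.1.2 - (u.2.1 - u.2.2) == d].

(** Representations of [b - a'] and [b - a] combine into one of [a - a' = (b - a') - (b - a)], from
    which [b] can be read off. *)
Lemma card_difference_reps_ge (V : finZmodType) (A B : {set V}) (a a' : V) :
  (\sum_(b in B) #|shift_meet A (b - a')%R| * #|shift_meet A (b - a)%R|
     <= #|difference_reps A (a - a')%R|)%N.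
Proof.
apply: leq_trans (sum_card_fibers _ (fun u => u.1.1 - u.1.2 + a') B).
apply: leq_sum => b _; rewrite -cardsX.
pose f (u : V * V) := ((u.1 + (b - a'), u.1), (u.2 + (b - a), u.2)).
have f_inj : injective f by move=> [x y] [x' y'] [_ -> _ ->].
rewrite -(card_imset _ f_inj); apply/subset_leq_card/fintype.subsetP => z /imsetP[[x y]].
rewrite !inE /= => /andP[/andP[xA x'A] /andP[yA y'A]] ->; rewrite /f /= xA x'A yA y'A /=.
apply/andP; split; apply/eqP.
  by rewrite ![_ + (b - _)]addrC !addrK opprB addrC addrA subrK.
by rewrite [x + _]addrC addrK subrK.
Qed.

(** The Balog-Szemeredi-Gowers step: [A'] keeps the elements of a popular [M] with few bad partners.
    Two of them share at least half of [M] as good partners [b], and each such [b] gives many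
    representations of [a - a']. *)
Lemma popular_differences (V : finZmodType) (A : {set V}) : (0 < #|A|)%N ->
  exists A' : {set V},
    [/\ A' \subset A, (energy A <= 16 * #|A| ^ 2 * #|A'|)%N
      & forall a a', a \in A' -> a' \in A' ->
        (energy A ^ 3 <= 8 * #|A| ^ 2 * (32 * #|A| ^ 2) ^ 2
                          * #|difference_reps A (a - a')%R|)%N].
Proof.
move=> A0; have [v [hbad hE]] := exists_popular_shift A0.
set M := shift_meet A v in hbad hE; set m := #|M| in hbad hE.
pose bad a := [set b in M | is_bad A a b].
pose A' := [set a in M | 4 * #|bad a| <= m]%N.
(* By Markov's inequality, less than a quarter of [M] is discarded. *)
have hB : (4 * #|[set a in M | m < 4 * #|bad a|]%N| < m)%N.
  set B := [set a in M | _].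
  have : (\sum_(a in B) m <= \sum_(a in B) 4 * #|bad a|)%N.
    by apply: leq_sum => a; rewrite inE => /andP[_ /ltnW].
  have : (\sum_(a in B) 4 * #|bad a| <= 4 * bad_pairs A v)%N.
    rewrite /bad_pairs big_distrr /= [X in (X <= _)%N]big_mkcond [X in (_ <= X)%N]big_mkcond.
    by apply: leq_sum => a _; rewrite inE; case: (a \in M) => //; case: ifP.
  rewrite sum_nat_const => h1 h2; have := leq_trans h2 h1.
  by move: hbad; move: (bad_pairs A v) #|B| => x y; rewrite -mulnn; nia.
exists A'; split.
- apply/fintype.subsetP => a; rewrite !inE => /andP[/andP[]] //.
- have : (m <= #|A'| + #|[set a in M | m < 4 * #|bad a|]%N|)%N.
    rewrite -[X in (X <= _)%N](cardsID A' M) leq_add //; apply/subset_leq_card/fintype.subsetP => a.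
      by rewrite inE => /andP[].
    rewrite !inE ltnNge => /andP[h /andP[aA avA]]; move: h. by rewrite aA avA.
  move: hB hE; move: (energy A) (#|A| ^ 2)%N #|A'| #|_| => e n x y; nia.
move=> a a'; rewrite !inE => /andP[_ ha] /andP[_ ha'].
pose G := M :\: (bad a :|: bad a').
have hG : (m <= 2 * #|G|)%N.
  have : (#|M :&: (bad a :|: bad a')| <= #|bad a| + #|bad a'|)%N.
    by apply: leq_trans (leq_card_setU _ _); rewrite subset_leq_card // subsetIr.
  have := cardsID (bad a :|: bad a') M; rewrite -/G -/m.
  move: ha ha'; move: #|bad a| #|bad a'| #|G| #|_| => x y z w; lia.
have hb b c : b \in G -> c \in [:: a; a'] ->
    (energy A <= 32 * #|A| ^ 2 * #|shift_meet A (b - c)%R|)%N.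
  rewrite !inE negb_or => /andP[/andP[h1 h2] /andP[bA bvA]].
  rewrite bA bvA /= in h1 h2.
  by case/orP => /eqP ->; rewrite leqNgt.
have hr : (#|G| * energy A ^ 2 <= (32 * #|A| ^ 2) ^ 2 * #|difference_reps A (a - a')%R|)%N.
  apply: leq_trans (leq_mul (leqnn _) (card_difference_reps_ge A G a a')).
  rewrite big_distrr /= -sum_nat_const leq_sum // => b bG.
  have := leq_mul (hb b a' bG _) (hb b a bG _); rewrite !inE !eqxx orbT => /(_ isT isT).
  by rewrite -!mulnn mulnACA.
rewrite expnS -mulnA.
have hEG : (energy A <= 8 * #|A| ^ 2 * #|G|)%N.
  move: hE hG; move: (energy A) (#|A| ^ 2)%N #|G| => e n x; nia.
apply: leq_trans (leq_mul hEG (leqnn _)) _.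
by rewrite -mulnA leq_mul.
Qed.

(** * Energy of sets with small multiplicative doubling *)

Lemma quotient_set_has0 (F : finFieldType) (A : {set F}) a b :
  a \in A -> b \in A -> b != a -> 0 \in quotient_set A.
Proof.
by move=> aA bA ba; apply/quotient_setP; exists a, a, b, a; rewrite subrr mul0r.
Qed.

(** Redei's bound is applied to [A] if [#|A| ^ 2 <= p], and otherwise to a subset whose size [m] is
    the integer part of the square root of [p]. *)
Lemma card_quotient_set_ge (p : nat) (A : {set 'F_p}) : prime p -> (1 < #|A|)%N ->
  (#|A| ^ 2 <= 2 * #|quotient_set A|)%N \/ (p <= 4 * #|quotient_set A|)%N.
Proof.
move=> p_pr A1; have [Ap|pA] := leqP (#|A| * #|A|) p.
  left; have := card_quotient_set_gt p_pr A1 Ap.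
  by rewrite -mulnn; move: #|A| #|quotient_set A| A1 => n q; nia.
right; have [m [mp pm]] : exists m, (m * m <= p)%N /\ (p < m.+1 * m.+1)%N.
  have ex0 : exists m, (m * m <= p)%N by exists 0.
  have bd m : (m * m <= p)%N -> (m <= p)%N by nia.
  have [m mp mmax] := ex_maxnP ex0 bd; exists m; split=> //.
  by rewrite ltnNge; apply/negP => /mmax; rewrite ltnn.
have mA : (m <= #|A|)%N by move: #|A| pA => n; nia.
have [B sBA cB] : exists2 B : {set 'F_p}, B \subset A & #|B| = m.
  exists [set x in take m (enum A)].
    by apply/fintype.subsetP => x; rewrite inE => /mem_take; rewrite mem_enum.
  rewrite cardsE (card_uniqP _) ?take_uniq ?enum_uniq // size_takel //.
  by rewrite -cardE.
have [m1|m1] := ltnP 1 m.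
  have B1 : (1 < #|B|)%N by rewrite cB.
  have Bp : (#|B| * #|B| <= p)%N by rewrite cB.
  have := card_quotient_set_gt p_pr B1 Bp; rewrite cB.
  have := subset_leq_card (quotient_setS sBA).
  by move: #|quotient_set A| #|quotient_set B| => x y; nia.
(* Now [m <= 1] and [p < 4], so a nonempty quotient set suffices. *)
have [a [b [aA bA ba]]] := exists_distinct_pair A1.
have : (0 < #|quotient_set A|)%N.
  by rewrite card_gt0; apply/set0Pn; exists 0; apply: quotient_set_has0 ba.
by move: #|quotient_set A| => x; nia.
Qed.

Definition product_set (F : finFieldType) (A B : {set F}) : {set F} :=
  [set u.1 * u.2 | u in finset.setX A B].

Lemma mem_product_set (F : finFieldType) (A B : {set F}) x y :
  x \in A -> y \in B -> x * y \in product_set A B.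
Proof. by move=> xA yB; apply/imsetP; exists (x, y); rewrite ?inE ?xA. Qed.

Definition difference_set (F : finFieldType) (A : {set F}) : {set F} :=
  [set u.1 - u.2 | u in finset.setX A A].

Lemma card_difference_reps_mul (F : finFieldType) (A : {set F}) d c :
  c \in A -> c != 0 ->
  (#|difference_reps A d| <= #|difference_reps (product_set A A) (d * c)%R|)%N.
Proof.
move=> cA c0.
pose f (u : (F * F) * (F * F)) := ((u.1.1 * c, u.1.2 * c), (u.2.1 * c, u.2.2 * c)).
have f_inj : injective f.
  move=> [[x y] [z t]] [[x' y'] [z' t']].
  by case=> /(mulIf c0)-> /(mulIf c0)-> /(mulIf c0)-> /(mulIf c0)->.
rewrite -(card_imset _ f_inj); apply/subset_leq_card/fintype.subsetP => w /imsetP[[[x y] [z t]]].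
rewrite inE /= => /andP[]; rewrite !inE /= => /andP[/andP[xA yA] /andP[zA tA]] /eqP <- ->.
by rewrite /= !mem_product_set //= !mulrBl.
Qed.

(** Dilation by [c] in [A] turns the representations of [a - a'] into representations of
    [(a - a') * c] by quadruples from the product set. *)
Lemma card_difference_product (F : finFieldType) (A A' : {set F}) (e k : nat) :
  0 \notin A ->
  (forall a a', a \in A' -> a' \in A' -> (e <= k * #|difference_reps A (a - a')%R|)%N) ->
  (#|product_set (difference_set A') A| * e <= k * #|product_set A A| ^ 4)%N.
Proof.
move=> A0 he; set W := product_set _ _.
have := sum_card_fibers (finset.setX (finset.setX (product_set A A) (product_set A A))
   (finset.setX (product_set A A) (product_set A A)))
   (fun u => u.1.1 - u.1.2 - (u.2.1 - u.2.2)) W.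
have -> : (#|finset.setX (finset.setX (product_set A A) (product_set A A))
   (finset.setX (product_set A A) (product_set A A))| = #|product_set A A| ^ 4)%N.
  by rewrite !cardsX -[4%N]/(2 + 2)%N expnD -!mulnn.
move=> h; apply: leq_trans (leq_mul (leqnn k) h).
rewrite -sum_nat_const big_distrr /= leq_sum // => w.
move=> /imsetP[[d c]]; rewrite inE /= => /andP[/imsetP[[a a']]].
rewrite inE /= => /andP[aA a'A] -> cA ->.
apply: leq_trans (he _ _ aA a'A) _; rewrite leq_mul //.
by apply: card_difference_reps_mul => //; apply: contraNneq A0 => <-.
Qed.

(** A quotient equals [((a - b) * x) / ((c - d) * x)] for every [x] in [A], and these [#|A|] pairs
    are distinct because [c != d]. *)
Lemma card_quotient_set_mul (F : finFieldType) (A A' : {set F}) : 0 \notin A ->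
  (#|quotient_set A'| * #|A| <= #|product_set (difference_set A') A| ^ 2)%N.
Proof.
move=> A0; set W := product_set _ _; rewrite -sum_nat_const -mulnn -[X in (_ <= X)%N]cardsX.
apply: leq_trans (sum_card_fibers _ (fun u : F * F => u.1 / u.2) _); apply: leq_sum => q.
move=> /quotient_setP[a [b [c [d [[aA bA cA dA] cd ->]]]]].
have cd0 : c - d != 0 by rewrite subr_eq0.
have f_inj : injective (fun x : F => ((a - b) * x, (c - d) * x)).
  by move=> x y [_ /(mulfI cd0)].
rewrite -(card_imset _ f_inj); apply/subset_leq_card/fintype.subsetP => w /imsetP[x xA ->].
have x0 : x != 0 by apply: contraNneq A0 => <-.
have dA' y z : y \in A' -> z \in A' -> y - z \in difference_set A'.
  by move=> yA zA; apply/imsetP; exists (y, z); rewrite ?inE /= ?yA.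
rewrite !inE /= !mem_product_set ?dA' //=; apply/eqP.
by rewrite invfM mulrACA divff // mulr1.
Qed.

Section EnergyCalc.
Local Open Scope nat_scope.

(** Here [n], [q], [w] stand for the sizes of [A'], of its quotient set and of [W]. The chain is
    [E^8 N <= 256 N^5 n^2 E^6 <= 512 N^5 q E^6 <= 512 N^4 (w E^3)^2]. *)
Lemma energy_calc_quotient (E N n q w c : nat) : 0 < N ->
  E <= 16 * N ^ 2 * n -> w * E ^ 3 <= c * N ^ 10 -> q * N <= w ^ 2 ->
  n ^ 2 <= 2 * q -> E ^ 8 <= 512 * c ^ 2 * N ^ 23.
Proof.
move=> N0 hE hW hq hn; rewrite -(leq_pmul2r N0).
have hE2 : E ^ 2 <= (16 * N ^ 2 * n) ^ 2 by rewrite leq_exp2r.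
have hW2 : (w * E ^ 3) ^ 2 <= (c * N ^ 10) ^ 2 by rewrite leq_exp2r.
apply: (@leq_trans ((16 * N ^ 2 * n) ^ 2 * (E ^ 6 * N))).
  have -> : E ^ 8 * N = E ^ 2 * (E ^ 6 * N) by ring.
  exact: leq_mul.
apply: (@leq_trans (256 * N ^ 4 * E ^ 6 * N * (2 * q))).
  have -> : (16 * N ^ 2 * n) ^ 2 * (E ^ 6 * N) = 256 * N ^ 4 * E ^ 6 * N * n ^ 2 by ring.
  exact: leq_mul.
apply: (@leq_trans (512 * N ^ 4 * E ^ 6 * w ^ 2)).
  have -> : 256 * N ^ 4 * E ^ 6 * N * (2 * q) = 512 * N ^ 4 * E ^ 6 * (q * N) by ring.
  exact: leq_mul.
have -> : 512 * N ^ 4 * E ^ 6 * w ^ 2 = 512 * N ^ 4 * (w * E ^ 3) ^ 2 by ring.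
have -> : 512 * c ^ 2 * N ^ 23 * N = 512 * N ^ 4 * (c * N ^ 10) ^ 2 by ring.
exact: leq_mul.
Qed.

Lemma difference_product_calc (a b d N : nat) :
  a * N ^ 2 * (b * N ^ 2) ^ 2 * (d * N) ^ 4 = a * b ^ 2 * d ^ 4 * N ^ 10.
Proof. ring. Qed.

Lemma energy_calc_prime (E N p q w c : nat) : 0 < N ->
  w * E ^ 3 <= c * N ^ 10 -> q * N <= w ^ 2 ->
  p <= 4 * q -> p * E ^ 6 <= 4 * c ^ 2 * N ^ 19.
Proof.
move=> N0 hW hq hp; rewrite -(leq_pmul2r N0).
have hW2 : (w * E ^ 3) ^ 2 <= (c * N ^ 10) ^ 2 by rewrite leq_exp2r.
apply: (@leq_trans (4 * q * (E ^ 6 * N))); first by rewrite -mulnA leq_mul.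
have -> : 4 * q * (E ^ 6 * N) = 4 * E ^ 6 * (q * N) by ring.
apply: (@leq_trans (4 * E ^ 6 * w ^ 2)); first exact: leq_mul.
have -> : 4 * E ^ 6 * w ^ 2 = 4 * (w * E ^ 3) ^ 2 by ring.
have -> : 4 * c ^ 2 * N ^ 19 * N = 4 * (c * N ^ 10) ^ 2 by ring.
exact: leq_mul.
Qed.

End EnergyCalc.

Lemma energy_le_of_small_doubling : exists C : nat,
  forall (p : nat) (A : {set 'F_p}), prime p -> 0 \notin A ->
    (#|product_set A A| <= 2 * #|A|)%N ->
    (energy A ^ 8 <= C * #|A| ^ 23)%N \/ (p * energy A ^ 6 <= C * #|A| ^ 19)%N.
Proof.
(* The factor [8 * 32 ^ 2] comes from [popular_differences], and [2 ^ 4] from the doubling.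
   Constants are kept as variables to avoid large numerals. *)
have [c hc] : exists c, (8 * 32 ^ 2 * 2 ^ 4)%N = c by eexists.
have [C [hC1 hC2 hC3]] : exists C, [/\ 512 * c ^ 2 <= C, 4 * c ^ 2 <= C & 16 ^ 8 <= C]%N.
  exists (512 * c ^ 2 + 16 ^ 8)%N; split; [exact: leq_addr| |exact: leq_addl].
  by apply: leq_trans (leq_addr _ _); apply: leq_mul.
exists C => p A p_pr A0 hAA.
have [A00|Apos] := posnP #|A|.
  left; have := energy_le_cube A; rewrite A00 !exp0n // muln0 leqn0 => /eqP ->.
  by rewrite exp0n.
have [A' [sA' hE hreps]] := popular_differences Apos.
set W := product_set (difference_set A') A.
have hW : (#|W| * energy A ^ 3 <= c * #|A| ^ 10)%N.
  apply: leq_trans (card_difference_product A0 hreps) _.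
  have hAA4 : (#|product_set A A| ^ 4 <= (2 * #|A|) ^ 4)%N by rewrite leq_exp2r.
  apply: leq_trans (leq_mul (leqnn _) hAA4) _.
  by rewrite difference_product_calc hc.
have hQW := card_quotient_set_mul A' A0; rewrite -/W in hQW.
(* Without two elements in [A'] there are no quotients, but then [E <= 16 N^2]; this is why [C]
   contains [16 ^ 8]. *)
have [A'1|A'1] := leqP #|A'| 1.
  left; have hE1 : (energy A <= 16 * #|A| ^ 2)%N.
    by apply: leq_trans hE _; rewrite -[X in (_ <= X)%N]muln1 leq_mul.
  have hE8 : (energy A ^ 8 <= (16 * #|A| ^ 2) ^ 8)%N by rewrite leq_exp2r.
  by apply: leq_trans hE8 _; rewrite expnMn -expnM leq_mul // leq_pexp2l.
case: (card_quotient_set_ge p_pr A'1) => hQ.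
  left; apply: leq_trans (energy_calc_quotient Apos hE hW hQW hQ) _.
  by rewrite leq_mul.
right; apply: leq_trans (energy_calc_prime Apos hW hQW hQ) _.
by rewrite leq_mul.
Qed.

(** * Additive characters and moments *)

Section ComplexModulus.
Variable R : realType.
Implicit Types x y z : R[i].
Local Open Scope complex_scope.

(** The norm of [R[i]] takes values in [R[i]]; this is the same number in [R], where [lra]
    applies. *)
Definition modulus z : R := complex.Re `|z|.

Lemma modulusE z : `|z| = (modulus z)%:C.
Proof. by rewrite /modulus normc_def. Qed.

Lemma modulus_ge0 z : 0 <= modulus z.
Proof. by have := normr_ge0 z; rewrite modulusE -[0]/(0%:C) lecR. Qed.

Lemma modulus0 : modulus 0 = 0.
Proof. by apply: complexI; rewrite -modulusE normr0. Qed.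

Lemma modulusM x y : modulus (x * y) = modulus x * modulus y.
Proof. by apply: complexI; rewrite rmorphM -!modulusE normrM. Qed.

Lemma modulusN x : modulus (- x) = modulus x.
Proof. by rewrite /modulus normrN. Qed.

Lemma modulusD x y : modulus (x + y) <= modulus x + modulus y.
Proof. by rewrite -lecR rmorphD -!modulusE ler_normD. Qed.

Lemma modulusB x y : modulus (x - y) <= modulus x + modulus y.
Proof. by rewrite -(modulusN y) modulusD. Qed.

Lemma modulus_sum (I : Type) (r : seq I) (P : pred I) (F : I -> R[i]) :
  modulus (\sum_(i <- r | P i) F i) <= \sum_(i <- r | P i) modulus (F i).
Proof.
elim/big_rec2: _ => [|i x y _ le_xy]; first by rewrite modulus0.
by apply: le_trans (modulusD _ _) _; rewrite lerD2l.
Qed.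

Lemma modulus_real (a : R) : 0 <= a -> modulus a%:C = a.
Proof. by move=> a0; apply: complexI; rewrite -modulusE ger0_norm // -[0]/(0%:C) lecR. Qed.

Lemma sqr_modulus z : (modulus z ^+ 2)%:C = z * z^*.
Proof. by rewrite -sqr_normc modulusE rmorphXn. Qed.

End ComplexModulus.

Section AdditiveCharacter.
Variables (R : realType) (p : nat).
Hypothesis p_pr : prime p.
Local Open Scope complex_scope.

Lemma expiD (x y : R) : expi (x + y) = expi x * expi y.
Proof. by rewrite /expi cosD sinD; apply/eqP; rewrite eq_complex /= !eqxx /= addrC. Qed.

Lemma expi0 : expi (0 : R) = 1.
Proof. by rewrite /expi cos0 sin0. Qed.

Lemma expiMn (x : R) n : expi (n%:R * x) = expi x ^+ n.
Proof.
elim: n => [|n IHn]; first by rewrite mul0r expi0.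
by rewrite exprS -IHn -expiD -nat1r mulrDl mul1r.
Qed.

Lemma epE (z : 'F_p) : ep R z = expi (2 * pi / p%:R) ^+ z.
Proof. by rewrite -expiMn /ep; congr expi; ring. Qed.

Lemma expi_root : expi (2 * pi / p%:R : R) ^+ p = 1.
Proof.
rewrite -expiMn mulrCA divff ?pnatr_eq0 ?mulr1; last by rewrite -lt0n prime_gt0.
by rewrite /expi mulr_natl cos2pi sin2pi.
Qed.

Lemma epD (x y : 'F_p) : ep R (x + y) = ep R x * ep R y.
Proof.
rewrite !epE -exprD -[RHS](expr_mod _ expi_root) /=.
by congr (_ ^+ _); congr modn; exact: Fp_cast.
Qed.

Lemma ep0 : ep R (0 : 'F_p) = 1.
Proof. by rewrite epE expr0. Qed.

Lemma modulus_ep (x : 'F_p) : modulus (ep R x) = 1.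
Proof.
apply: complexI; rewrite -modulusE normc_def /ep /expi /=.
by rewrite cos2Dsin2 sqrtr1.
Qed.

Lemma conjc_ep (x : 'F_p) : (ep R x)^* = ep R (- x).
Proof.
have h : ep R x * ep R (- x) = 1 by rewrite -epD subrr ep0.
have := sqr_modulus (ep R x); rewrite modulus_ep expr1n => h'.
have x0 : ep R x != 0 by apply: contraTneq (oner_neq0 R[i]) => x0; rewrite -h x0 mul0r eqxx.
by apply: (mulfI x0); rewrite -h' h.
Qed.

(** The real part is [1 - 2 sin^2 (pi x / p)] with [pi x / p] strictly between [0] and [pi]. *)
Lemma ep_neq1 (x : 'F_p) : x != 0 -> ep R x != 1.
Proof.
move=> x0; rewrite /ep /expi eq_complex /= negb_and; apply/orP; left.
have xp : (x < p)%N by apply: leq_trans (ltn_ord x) _; rewrite (Fp_cast p_pr).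
have p0 : 0 < p%:R :> R by rewrite ltr0n prime_gt0.
have -> : 2 * pi * (x : nat)%:R / p%:R = (pi * ((x : nat)%:R / p%:R)) *+ 2 :> R.
  by rewrite -mulr_natl; ring.
rewrite cos_mulr2n cos2sin2.
have : 0 < sin (pi * ((x : nat)%:R / p%:R)) :> R.
  have xn0 : (0 < x)%N by rewrite lt0n; exact: x0.
  apply: sin_gt0_pi; rewrite mulr_gt0 ?pi_gt0 ?divr_gt0 ?ltr0n ?(prime_gt0 p_pr) //=.
  by rewrite -[ltRHS]mulr1 ltr_pM2l ?pi_gt0 // ltr_pdivrMr // mul1r ltr_nat.
move=> s0; apply/eqP => h.
have : 0 < sin (pi * ((x : nat)%:R / p%:R)) ^+ 2 :> R by rewrite exprn_gt0.
by lra.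
Qed.

(** Orthogonality: translating [u] by [1] multiplies the sum by [ep R v]. *)
Lemma sum_ep (v : 'F_p) : \sum_u ep R (u * v) = (v == 0)%:R * p%:R.
Proof.
have [->|v0] := eqVneq v 0.
  rewrite (eq_bigr (fun=> 1)) => [|u _]; last by rewrite mulr0 ep0.
  by rewrite sumr_const card_Fp // mul1r.
set S := \sum_u _; rewrite mul0r.
have eS : S = S * ep R v.
  rewrite {1}/S (reindex_inj (addIr 1)) /= big_distrl /=.
  by apply: eq_bigr => u _; rewrite mulrDl mul1r epD.
have /eqP : S * (1 - ep R v) = 0 by rewrite mulrBr mulr1 -eS subrr.
rewrite mulf_eq0 => /orP[/eqP //|]; rewrite subr_eq0 eq_sym.
by rewrite (negPf (ep_neq1 v0)).
Qed.

End AdditiveCharacter.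

(** By Lagrange's identity, the difference of the two sides is half a double sum of weighted
    squares. *)
Lemma weighted_cauchy_schwarz (R : realFieldType) (I : finType) (w f g : I -> R) :
  (forall i, 0 <= w i) ->
  (\sum_i w i * (f i * g i)) ^+ 2
    <= (\sum_i w i * f i ^+ 2) * (\sum_i w i * g i ^+ 2).
Proof.
move=> w0.
have h : 0 <= \sum_i \sum_j w i * w j * (f i * g j - f j * g i) ^+ 2.
  by apply: sumr_ge0 => i _; apply: sumr_ge0 => j _; rewrite mulr_ge0 ?sqr_ge0 // mulr_ge0.
suff e : \sum_i \sum_j w i * w j * (f i * g j - f j * g i) ^+ 2
   = 2 * ((\sum_i w i * f i ^+ 2) * (\sum_i w i * g i ^+ 2)
          - (\sum_i w i * (f i * g i)) ^+ 2) by move: h; rewrite e; lra.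
rewrite expr2 !big_distrlr /= mulrBr mulr_sumr mulr2n.
transitivity (\sum_i (\sum_j (w i * f i ^+ 2) * (w j * g j ^+ 2)
    + \sum_j (w j * f j ^+ 2) * (w i * g i ^+ 2)
    - 2 * \sum_j (w i * (f i * g i)) * (w j * (f j * g j)))).
  apply: eq_bigr => i _; rewrite mulr_sumr -big_split /= -sumrB.
  by apply: eq_bigr => j _; ring.
rewrite sumrB big_split /= -mulr_sumr [X in _ + X - _]exchange_big /=.
by rewrite -mulr_sumr; ring.
Qed.

Section Moments.
Variables (R : realType) (p : nat).
Hypothesis p_pr : prime p.
Local Open Scope complex_scope.

Definition charsum (A : {set 'F_p}) (u : 'F_p) : R[i] := \sum_(a in A) ep R (u * a).

Lemma sqr_charsum A u :
  (modulus (charsum A u) ^+ 2)%:C = \sum_v #|shift_meet A v|%:R * ep R (u * v).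
Proof.
rewrite sqr_modulus /charsum rmorph_sum big_distrlr /= exchange_big /=.
transitivity (\sum_(b in A) \sum_v (b + v \in A)%:R * ep R (u * v)).
  apply: eq_bigr => b _; rewrite [RHS](reindex_inj (addIr (- b))) [LHS]big_mkcond /=.
  apply: eq_bigr => a _. have -> : b + (a - b) = a by rewrite addrC subrK.
  rewrite mulrBr epD // -conjc_ep //.
  by case: (a \in A); rewrite ?mul1r ?mul0r.
rewrite exchange_big; apply: eq_bigr => v _.
by rewrite card_shift_meet natr_sum big_distrl.
Qed.

(** After expanding twice by [sqr_charsum], orthogonality in [u] leaves the terms with [v = w]. *)
Lemma sum_charsum4 A : \sum_u modulus (charsum A u) ^+ 4 = p%:R * (energy A)%:R.
Proof.
apply: complexI; rewrite rmorph_sum rmorphM !rmorph_nat /=.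
transitivity (\sum_u \sum_v \sum_w
    (#|shift_meet A v|%:R * #|shift_meet A w|%:R * ep R (u * (v - w)) : R[i])).
  apply: eq_bigr => u _; rewrite -[4%N]/(2 * 2)%N exprM expr2 rmorphM /=.
  rewrite -[X in _ * X = _]conjc_real sqr_charsum rmorph_sum big_distrlr.
  apply: eq_bigr => v _; apply: eq_bigr => w _ /=.
  have conjcM (x y : R[i]) : conjc (x * y) = conjc x * conjc y by exact: rmorphM.
  rewrite conjcM conjc_nat conjc_ep // mulrBr epD //; ring.
rewrite exchange_big /energy natr_sum mulr_sumr; apply: eq_bigr => v _.
rewrite exchange_big (bigD1 v) //= [X in _ + X]big1 => [|w wv].
  rewrite -mulr_sumr (eq_bigr (fun u => ep R (u * 0))) => [|u _]; last by rewrite subrr.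
  by rewrite sum_ep // eqxx mul1r addr0 mulrC natrX.
by rewrite -mulr_sumr sum_ep // subr_eq0 eq_sym (negPf wv) mul0r mulr0.
Qed.

(** Expanding the squares and summing over [x] first bounds the sum by that of [r v * T v].
    Cauchy-Schwarz with weight [r] leads to the sum of [r v * T v ^+ 2], and a second use brings in
    the energy and the fourth moment. *)
Lemma sum_charsum2_le (A : {set 'F_p}) (l : 'F_p) : l != 0 ->
  (\sum_(x in A) modulus (charsum A (l * x)) ^+ 2) ^+ 4
    <= #|A|%:R ^+ 4 * (p%:R * (energy A)%:R ^+ 2).
Proof.
move=> l0; set X := \sum_(x in A) _.
have X0 : 0 <= X by apply: sumr_ge0 => x _; rewrite sqr_ge0.
pose r v : R := #|shift_meet A v|%:R; pose T v := modulus (charsum A (l * v)).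
have sum_r : \sum_v r v = #|A|%:R ^+ 2 by rewrite -natr_sum sum_card_shift_meet natrX.
have sum_r2 : \sum_v r v ^+ 2 = (energy A)%:R.
  by rewrite natr_sum; apply: eq_bigr => v _; rewrite natrX.
have sum_T4 : \sum_v T v ^+ 4 = p%:R * (energy A)%:R.
  by rewrite -sum_charsum4 [RHS](reindex_inj (mulfI l0)).
have XrT : X <= \sum_v r v * T v.
  have -> : X = modulus (\sum_v (r v)%:C * charsum A (l * v)).
    rewrite -(modulus_real X0); congr modulus.
    rewrite rmorph_sum /= (eq_bigr _ (fun x _ => sqr_charsum A (l * x))) exchange_big.
    apply: eq_bigr => v _; rewrite /charsum mulr_sumr; apply: eq_bigr => x _.
    by rewrite rmorph_nat; congr (_ * ep R _); ring.
  apply: le_trans (modulus_sum _ _ _) _; apply: ler_sum => v _.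
  by rewrite modulusM modulus_real // ler0n.
have h1 : (\sum_v r v * T v) ^+ 2 <= #|A|%:R ^+ 2 * \sum_v r v * T v ^+ 2.
  have := weighted_cauchy_schwarz (fun=> 1) T (fun v => ler0n R #|shift_meet A v|).
  rewrite -sum_r; under eq_bigr do rewrite mul1r.
  by under [X in _ <= X * _]eq_bigr do rewrite expr1n mulr1.
have h2 : (\sum_v r v * T v ^+ 2) ^+ 2 <= (energy A)%:R * (p%:R * (energy A)%:R).
  have := weighted_cauchy_schwarz r (fun v => T v ^+ 2) (fun _ => ler01).
  under eq_bigr do rewrite mul1r; under [X in _ <= X * _]eq_bigr do rewrite mul1r.
  under [X in _ <= _ * X]eq_bigr do rewrite mul1r -exprM.
  by rewrite sum_r2 sum_T4.
have rT0 : 0 <= \sum_v r v * T v ^+ 2.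
  by apply: sumr_ge0 => v _; rewrite mulr_ge0 ?sqr_ge0 ?ler0n.
have rT1 : 0 <= \sum_v r v * T v.
  by apply: sumr_ge0 => v _; rewrite mulr_ge0 ?modulus_ge0 ?ler0n.
apply: (@le_trans _ _ ((\sum_v r v * T v) ^+ 4)); first by rewrite lerXn2r.
apply: (@le_trans _ _ ((#|A|%:R ^+ 2 * \sum_v r v * T v ^+ 2) ^+ 2)).
  by rewrite -[4%N]/(2 * 2)%N exprM lerXn2r ?nnegrE ?mulr_ge0 ?sqr_ge0 // exprn_ge0 ?ler0n.
rewrite exprMn -exprM ler_wpM2l ?exprn_ge0 ?ler0n //.
by apply: le_trans h2 _; rewrite le_eqVlt; apply/orP; left; apply/eqP; ring.
Qed.

End Moments.

(** * Sums over geometric progressions *)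

Section EnergyPower.
Local Open Scope nat_scope.

(** The cube of the first alternative gives [N^69], the fourth power of the second
    [N^76 / p^4 <= N^68]. *)
Lemma energy_power_calc_small (E N p c : nat) : 0 < N -> N ^ 2 <= p ->
  E ^ 8 <= c * N ^ 23 \/ p * E ^ 6 <= c * N ^ 19 ->
  E ^ 24 <= (c ^ 3 + c ^ 4) * N ^ 71.
Proof.
move=> N0 Np [hE|hE].
  have h : (E ^ 8) ^ 3 <= (c * N ^ 23) ^ 3 by rewrite leq_exp2r.
  rewrite -expnM expnMn -expnM in h; apply: leq_trans h _.
  by apply: leq_mul; [exact: leq_addr | rewrite leq_pexp2l].
have h : p ^ 4 * (E ^ 6) ^ 4 <= c ^ 4 * (N ^ 19) ^ 4 by rewrite -!expnMn leq_exp2r.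
rewrite -!expnM in h.
have h2 : (N ^ 2) ^ 4 <= p ^ 4 by rewrite leq_exp2r.
have N8 : 0 < (N ^ 2) ^ 4 by rewrite !expn_gt0 N0.
rewrite -(leq_pmul2l N8); apply: leq_trans (leq_mul h2 (leqnn _)) _.
apply: leq_trans h _. rewrite -expnM mulnCA -expnD.
by apply: leq_mul; [exact: leq_addl | rewrite leq_pexp2l].
Qed.

(** The same powers, now with [p <= N^2] in the first alternative and [N^3 <= p^3] in the second,
    give the exponents 71 and 73. *)
Lemma energy_power_calc_large (E N p c : nat) : 0 < N -> N <= p -> p <= N ^ 2 ->
  E ^ 8 <= c * N ^ 23 \/ p * E ^ 6 <= c * N ^ 19 ->
  p * E ^ 24 <= (c ^ 3 + c ^ 4) * N ^ 73.
Proof.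
move=> N0 Np pN [hE|hE].
  have h : (E ^ 8) ^ 3 <= (c * N ^ 23) ^ 3 by rewrite leq_exp2r.
  rewrite -expnM expnMn -expnM in h; apply: leq_trans (leq_mul pN h) _.
  rewrite mulnCA -expnD.
  by apply: leq_mul; [exact: leq_addr | rewrite leq_pexp2l].
have h : p ^ 4 * (E ^ 6) ^ 4 <= c ^ 4 * (N ^ 19) ^ 4 by rewrite -!expnMn leq_exp2r.
rewrite -!expnM in h.
have h2 : N ^ 3 <= p ^ 3 by rewrite leq_exp2r.
have N3 : 0 < N ^ 3 by rewrite expn_gt0 N0.
rewrite -(leq_pmul2l N3); apply: leq_trans (leq_mul h2 (leqnn _)) _.
rewrite mulnA -expnSr; apply: leq_trans h _; rewrite mulnCA -expnD.
by apply: leq_mul; [exact: leq_addl | rewrite leq_pexp2l].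
Qed.

End EnergyPower.

Section Progression.
Variables (p : nat) (g : {unit 'F_p}).
Hypothesis p_pr : prime p.

Definition progression (N : nat) : {set 'F_p} := [set val g ^+ n.+1 | n : 'I_N].

Lemma val_unit_neq0 : val g != 0 :> 'F_p.
Proof. by rewrite -unitfE (valP g). Qed.

Lemma notin0_progression N : 0 \notin progression N.
Proof.
apply/imsetP => -[n _ /esym/eqP]; apply/negP.
by rewrite expf_neq0 // val_unit_neq0.
Qed.

Lemma order_le_prime : (#[g]%g <= p)%N.
Proof.
rewrite -[X in (_ <= X)%N](card_Fp p_pr); apply: leq_trans (max_card _) _.
rewrite -(card_imset _ val_inj); exact: max_card.
Qed.

Lemma val_unitX n : val (g ^+ n)%g = val g ^+ n :> 'F_p.
Proof. by rewrite FinRing.val_unitX. Qed.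

Lemma inj_progression N : (N <= #[g]%g)%N ->
  injective (fun n : 'I_N => val g ^+ n.+1 : 'F_p).
Proof.
move=> Nt n m; rewrite -!val_unitX => /val_inj /eqP.
rewrite eq_expg_mod_order -addn1 -[m.+1]addn1 eqn_modDr => /eqP.
by rewrite !modn_small ?(leq_trans (ltn_ord _)) // => /val_inj.
Qed.

Lemma card_progression N : (N <= #[g]%g)%N -> #|progression N| = N.
Proof. by move=> Nt; rewrite card_imset ?card_ord //; apply: inj_progression. Qed.

(** All products are powers of [g] with exponents between [2] and [2 * N]. *)
Lemma card_product_progression N : (N <= #[g]%g)%N ->
  (#|product_set (progression N) (progression N)| <= 2 * #|progression N|)%N.
Proof.
move=> Nt; rewrite card_progression //.
have : (#|[set (val g ^+ n.+2)%R | n : 'I_(2 * N)]| <= 2 * N)%N.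
  by apply: leq_trans (leq_imset_card _ _) _; rewrite card_ord.
apply: leq_trans; apply/subset_leq_card/fintype.subsetP => x.
case/imsetP => -[y z]; rewrite inE /= => /andP[/imsetP[n _ ->] /imsetP[m _ ->]] ->.
have nm : (n + m < 2 * N)%N by have := ltn_ord n; have := ltn_ord m; lia.
by apply/imsetP; exists (Ordinal nm) => //=; rewrite -exprD addSn addnS.
Qed.

Definition geomsum (R : realType) (l : 'F_p) (N : nat) : R[i] :=
  \sum_(0 <= n < N) ep R (l * val g ^+ n.+1).

Lemma expsumE (R : realType) (lambda : int) N : expsum R g lambda N = geomsum R lambda%:~R N.
Proof. by rewrite /expsum big_add1. Qed.

Lemma geomsum_charsum (R : realType) l N : (N <= #[g]%g)%N ->
  geomsum R l N = charsum R (progression N) l.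
Proof.
move=> Nt; rewrite /geomsum big_mkord /charsum /progression big_imset //=.
by move=> n m _ _; apply: inj_progression.
Qed.

Lemma geomsumD (R : realType) l k N :
  geomsum R l (k + N) = geomsum R l k + geomsum R (l * val g ^+ k) N.
Proof.
rewrite /geomsum (@big_cat_nat _ _ _ k 0 (k + N)) ?leq_addr //=; congr (_ + _).
rewrite -{1}[k]add0n big_addn addKn; apply: eq_bigr => n _.
by rewrite -mulrA -exprD; congr (ep R (_ * _ ^+ _)); lia.
Qed.

(** The sum of length [k + N] is cut once after [k] terms and once after [N] terms. *)
Lemma geomsum_shift (R : realType) l k N :
  geomsum R l N
    = geomsum R (l * val g ^+ k) N + geomsum R l k - geomsum R (l * val g ^+ N) k.
Proof.
have e := geomsumD R l k N; rewrite addnC geomsumD in e.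
by apply: (canRL (addrK _)); rewrite e addrC.
Qed.

Lemma modulus_geomsum_le (R : realType) l N : modulus (geomsum R l N) <= N%:R.
Proof.
apply: le_trans (modulus_sum _ _ _) _.
rewrite (eq_bigr (fun=> 1)) => [|n _]; last by rewrite modulus_ep.
by rewrite sumr_const_nat subn0.
Qed.

End Progression.

(** * From moments to pointwise bounds *)

Section Bootstrap.
Variables (R : realType) (p : nat) (g : {unit 'F_p}).
Hypothesis p_pr : prime p.

Lemma sum_progression_ge (F : 'F_p -> R) K N : (K <= N)%N -> (N <= #[g]%g)%N ->
  (forall x, 0 <= F x) ->
  \sum_(0 <= k < K) F (val g ^+ k.+1) <= \sum_(x in progression g N) F x.
Proof.
move=> KN Nt F0; rewrite /progression big_imset /=; last first.
  by move=> n m _ _; apply: inj_progression.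
rewrite -(big_mkord xpredT (fun n => F (val g ^+ n.+1))) (@big_cat_nat _ _ _ K 0 N) //=.
by rewrite lerDl sumr_ge0.
Qed.

(** The [K] large translates bound the second and fourth moments over the progression from below.
    The constants are [128 = 32 * 2 ^ 2] and [512 = 32 * 2 ^ 4]. *)
Lemma large_translates_bound (K N : nat) (l : 'F_p) (V : R) :
  (K <= N)%N -> (N <= 32 * K)%N -> (N <= #[g]%g)%N -> (0 < N)%N -> l != 0 -> 0 <= V ->
  (forall k, (0 < k <= K)%N -> V / 2 <= modulus (geomsum g R (l * val g ^+ k) N)) ->
  V ^+ 8 <= 128 ^+ 4 * (p%:R * (energy (progression g N))%:R ^+ 2) /\
  N%:R * V ^+ 4 <= 512 * (p%:R * (energy (progression g N))%:R).
Proof.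
move=> KN NK Nt N0 l0 V0 hV; set E := (energy _)%:R.
set A := progression g N.
have cA : #|A| = N by rewrite card_progression.
have hlarge k : (k < K)%N -> V / 2 <= modulus (charsum R A (l * val g ^+ k.+1)).
  by move=> kK; rewrite -geomsum_charsum // hV.
have V2 : 0 <= V / 2 by rewrite divr_ge0.
have NK' : N%:R <= 32 * K%:R :> R by rewrite -natrM ler_nat.
have N0' : 0 < N%:R :> R by rewrite ltr0n.
have hsum m : K%:R * (V / 2) ^+ m <= \sum_(x in A) modulus (charsum R A (l * x)) ^+ m.
  apply: le_trans (sum_progression_ge KN Nt _); last by move=> x; rewrite exprn_ge0 ?modulus_ge0.
  rewrite mulr_natl -[X in _ *+ X](subn0 K) -sumr_const_nat.
  apply: ler_sum_nat => k /andP[_ kK].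
  by rewrite lerXn2r ?nnegrE ?modulus_ge0 ?hlarge.
split.
  have h1 : (K%:R * (V / 2) ^+ 2) ^+ 4 <= N%:R ^+ 4 * (p%:R * E ^+ 2).
    apply: le_trans (_ : (\sum_(x in A) modulus (charsum R A (l * x)) ^+ 2) ^+ 4 <= _).
      rewrite lerXn2r ?nnegrE ?hsum ?mulr_ge0 ?sqr_ge0 ?ler0n // sumr_ge0 // => x _.
      by rewrite sqr_ge0.
    by have := sum_charsum2_le R p_pr A l0; rewrite cA.
  have h2 : N%:R * V ^+ 2 <= 128 * (K%:R * (V / 2) ^+ 2).
    have : N%:R * V ^+ 2 <= 32 * K%:R * V ^+ 2 by rewrite ler_wpM2r ?sqr_ge0.
    by lra.
  have h3 : (N%:R * V ^+ 2) ^+ 4 <= (128 * (K%:R * (V / 2) ^+ 2)) ^+ 4.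
    by rewrite lerXn2r ?nnegrE ?mulr_ge0 ?sqr_ge0 ?ler0n.
  rewrite -(ler_pM2l (exprn_gt0 4 N0')).
  rewrite exprMn -exprM [X in _ <= X]exprMn in h3; apply: le_trans h3 _.
  by rewrite [leRHS]mulrCA ler_wpM2l ?exprn_ge0 //.
have h1 : K%:R * (V / 2) ^+ 4 <= p%:R * E.
  apply: le_trans (hsum 4) _; rewrite -(sum_charsum4 R p_pr A).
  rewrite [leRHS](reindex_inj (mulfI l0)) /= [leLHS]big_mkcond.
  by apply: ler_sum => x _; case: ifP => // _; rewrite exprn_ge0 ?modulus_ge0.
have h2 : N%:R * V ^+ 4 <= 32 * K%:R * V ^+ 4 by rewrite ler_wpM2r ?exprn_ge0.
by lra.
Qed.

(* If every short sum is at most [V / 4], then [geomsum_shift] makes all the translates of a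
   sum of modulus [V] by [g ^ k], [k <= N / 16], at least [V / 2]. *)
Lemma bootstrap_bound (b : nat -> R) (M : nat) : (M <= #[g]%g)%N ->
  (forall N, (N <= M)%N -> (N < 16)%N -> N%:R ^+ 96 <= b N) ->
  (forall k N, (16 * k <= N)%N -> (N <= M)%N -> 4 ^+ 96 * b k <= b N) ->
  (forall N (V : R), (16 <= N)%N -> (N <= M)%N -> 0 <= V ->
     V ^+ 8 <= 128 ^+ 4 * (p%:R * (energy (progression g N))%:R ^+ 2) ->
     N%:R * V ^+ 4 <= 512 * (p%:R * (energy (progression g N))%:R) -> V ^+ 96 <= b N) ->
  forall N (l : 'F_p), (N <= M)%N -> l != 0 -> modulus (geomsum g R l N) ^+ 96 <= b N.
Proof.
move=> Mt hbase hscale hstep; elim/ltn_ind => N IHN l NM l0.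
have [N16|N16] := ltnP N 16.
  apply: le_trans (hbase N NM N16).
  by rewrite lerXn2r ?nnegrE ?modulus_ge0 ?ler0n ?modulus_geomsum_le.
set V := modulus _; have V0 : 0 <= V by apply: modulus_ge0.
(* From here on [b N < V ^+ 96], which through [hscale] and induction bounds the short sums by
   [V / 4], and finally contradicts [hstep]. *)
have [//|bV] := leP (V ^+ 96) (b N).
have g0 : val g != 0 := val_unit_neq0 g.
(* Rounding down gives [16 * K <= N], as [hscale] requires, and [N <= 32 * K] because [N >= 16]. *)
pose K := (N %/ 16)%N.
have KN : (16 * K <= N)%N by rewrite mulnC leq_trunc_div.
have NK : (N <= 32 * K)%N by have := divn_eq N 16; have := @ltn_pmod N 16; rewrite -/K; lia.
have short k m : (0 < k <= K)%N -> m != 0 -> modulus (geomsum g R m k) <= V / 4.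
  move=> /andP[k0 kK] m0; have kN : (k < N)%N by lia.
  have hk := IHN k kN m (leq_trans (ltnW kN) NM) m0.
  have : (4 * modulus (geomsum g R m k)) ^+ 96 < V ^+ 96.
    apply: le_lt_trans bV; rewrite exprMn.
    apply: le_trans (hscale k N _ NM); last by lia.
    by rewrite ler_wpM2l // exprn_ge0.
  rewrite ltr_pXn2r ?nnegrE ?mulr_ge0 ?modulus_ge0 // => h; lra.
suff [h1 h2] : V ^+ 8 <= 128 ^+ 4 * (p%:R * (energy (progression g N))%:R ^+ 2) /\
    N%:R * V ^+ 4 <= 512 * (p%:R * (energy (progression g N))%:R).
  by rewrite ltNge (hstep N V) in bV.
apply: (@large_translates_bound K N l) => //; [lia|exact: leq_trans NM Mt|lia|].
move=> k kK; have s1 := short k l kK l0.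
have s2 : modulus (geomsum g R (l * val g ^+ N) k) <= V / 4.
  by apply: short => //; rewrite mulf_neq0 // expf_neq0.
have : V <= modulus (geomsum g R (l * val g ^+ k) N) + modulus (geomsum g R l k)
    + modulus (geomsum g R (l * val g ^+ N) k).
  rewrite /V (geomsum_shift g p_pr R l k N); apply: le_trans (modulusB _ _) _.
  by rewrite lerD2r modulusD.
by lra.
Qed.

End Bootstrap.

(** * Bounds for the 96th power of the sum *)

Lemma energy_progression_le : exists D : nat,
  forall (p : nat) (g : {unit 'F_p}) (N : nat), prime p -> (N <= #[g]%g)%N -> (0 < N)%N ->
  ((N ^ 2 <= p)%N -> (energy (progression g N) ^ 24 <= D * N ^ 71)%N) /\
  ((p <= N ^ 2)%N -> (p * energy (progression g N) ^ 24 <= D * N ^ 73)%N).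
Proof.
have [c hc] := energy_le_of_small_doubling; exists (c ^ 3 + c ^ 4)%N => p g N p_pr Nt N0.
have := hc p _ p_pr (notin0_progression g N) (card_product_progression p_pr Nt).
rewrite card_progression // => h; split=> hp; first exact: energy_power_calc_small h.
apply: energy_power_calc_large h => //.
exact: leq_trans Nt (order_le_prime g p_pr).
Qed.

(** Since [16 ^ m = 4 ^ (2 m)], the factor [4 ^ 96] is absorbed once [m >= 48]; the exponents 71 and
    49 both qualify. *)
Lemma pow96_scale (R : realDomainType) (m k N : nat) : (48 <= m)%N -> (16 * k <= N)%N ->
  4 ^+ 96 * k%:R ^+ m <= N%:R ^+ m :> R.
Proof.
move=> hm kN; apply: (@le_trans _ _ ((16 * k)%:R ^+ m)); last first.
  by rewrite lerXn2r ?nnegrE ?ler0n // ler_nat.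
rewrite natrM exprMn ler_wpM2r ?exprn_ge0 ?ler0n //.
have -> : 16%:R = 4 ^+ 2 :> R by rewrite -natrX.
by rewrite -exprM ler_eXn2l ?ltr1n //; lia.
Qed.

Lemma pow96_base (R : realDomainType) (C x : R) (m N : nat) : (m <= 96)%N -> (N < 16)%N ->
  16 ^+ (96 - m) <= C -> 1 <= x -> N%:R ^+ 96 <= C * x * N%:R ^+ m.
Proof.
move=> hm N16 hC x1.
have -> : N%:R ^+ 96 = N%:R ^+ (96 - m) * N%:R ^+ m :> R by rewrite -exprD subnK.
rewrite ler_wpM2r ?exprn_ge0 ?ler0n //; apply: (@le_trans _ _ (16 ^+ (96 - m))).
  by rewrite lerXn2r ?nnegrE ?ler0n // ler_nat ltnW.
have C0 : 0 <= C by apply: le_trans hC; rewrite exprn_ge0.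
by apply: le_trans hC _; rewrite ler_peMr.
Qed.

Lemma energy_step_small (R : realDomainType) (k p n V E D : R) :
  0 <= k -> 0 <= p -> 0 <= n -> 0 <= V ->
  V ^+ 8 <= k * (p * E ^+ 2) -> E ^+ 24 <= D * n ^+ 71 ->
  V ^+ 96 <= k ^+ 12 * D * p ^+ 12 * n ^+ 71.
Proof.
move=> k0 p0 n0 V0 hV hE.
have V8 : 0 <= V ^+ 8 by rewrite exprn_ge0.
have h : (V ^+ 8) ^+ 12 <= (k * (p * E ^+ 2)) ^+ 12.
  by apply: lerXn2r => //; rewrite nnegrE; exact: le_trans V8 hV.
have -> : V ^+ 96 = (V ^+ 8) ^+ 12 by rewrite -exprM.
apply: le_trans h _.
have -> : (k * (p * E ^+ 2)) ^+ 12 = k ^+ 12 * (p ^+ 12 * E ^+ 24).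
  by rewrite exprMn [(p * _) ^+ 12]exprMn -exprM.
have -> : k ^+ 12 * D * p ^+ 12 * n ^+ 71 = k ^+ 12 * (p ^+ 12 * (D * n ^+ 71)).
  by move: (k ^+ 12) (p ^+ 12) (n ^+ 71) => x y z; ring.
have k12 : 0 <= k ^+ 12 by rewrite exprn_ge0.
have p12 : 0 <= p ^+ 12 by rewrite exprn_ge0.
apply: (ler_wpM2l k12); exact: (ler_wpM2l p12).
Qed.

(** In the 24th power of the moment bound one factor [p] stays with [E ^+ 24], which leaves
    [p ^+ 23]; then [n ^+ 24] cancels. *)
Lemma energy_step_large (R : realDomainType) (k p n V E D : R) :
  0 <= k -> 0 < p -> 0 < n -> 0 <= V ->
  n * V ^+ 4 <= k * (p * E) -> p * E ^+ 24 <= D * n ^+ 73 ->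
  V ^+ 96 <= k ^+ 24 * D * p ^+ 23 * n ^+ 49.
Proof.
move=> k0 p0 n0 V0 hV hE; rewrite -(ler_pM2l (exprn_gt0 24 n0)).
have nV0 : 0 <= n * V ^+ 4 by rewrite mulr_ge0 ?exprn_ge0 ?(ltW n0).
have h : (n * V ^+ 4) ^+ 24 <= (k * (p * E)) ^+ 24.
  by apply: lerXn2r => //; rewrite nnegrE; exact: le_trans nV0 hV.
have -> : n ^+ 24 * V ^+ 96 = (n * V ^+ 4) ^+ 24 by rewrite exprMn -exprM.
apply: le_trans h _.
have -> : (k * (p * E)) ^+ 24 = k ^+ 24 * (p ^+ 23 * (p * E ^+ 24)).
  by rewrite exprMn [(p * _) ^+ 24]exprMn (exprSr p 23) (mulrA (p ^+ 23) p).
have -> : n ^+ 24 * (k ^+ 24 * D * p ^+ 23 * n ^+ 49)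
    = k ^+ 24 * (p ^+ 23 * (D * (n ^+ 24 * n ^+ 49))).
  by move: (k ^+ 24) (p ^+ 23) (n ^+ 24) (n ^+ 49) => x y z t; ring.
have k24 : 0 <= k ^+ 24 by rewrite exprn_ge0.
have p23 : 0 <= p ^+ 23 by rewrite exprn_ge0 ?ltW.
rewrite -exprD; apply: (ler_wpM2l k24); exact: (ler_wpM2l p23).
Qed.

Lemma exists_common_bound (R : realDomainType) (x y : R) : 0 < x -> 0 <= y ->
  exists C : R, [/\ 0 < C, x <= C & y <= C].
Proof.
by move=> x0 y0; exists (x + y); rewrite ltr_wpDr // lerDl y0 lerDr ltW.
Qed.

Lemma geomsum_bound_small (R : realType) : exists2 C : R, 0 < C &
  forall (p : nat) (g : {unit 'F_p}) (N : nat) (l : 'F_p), prime p -> (N <= #[g]%g)%N ->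
  (N ^ 2 <= p)%N -> l != 0 ->
  modulus (geomsum g R l N) ^+ 96 <= C * p%:R ^+ 12 * N%:R ^+ 71.
Proof.
have [D hD] := energy_progression_le.
(* The power [16 ^+ 25], with [25 = 96 - 71], serves sums of fewer than 16 terms; the other bound
   serves the inductive step. *)
have [C [C0 C16C CDC]] : exists C : R,
    [/\ 0 < C, 16 ^+ 25 <= C & (128 ^+ 4) ^+ 12 * D%:R <= C].
  apply: exists_common_bound; first by rewrite exprn_gt0.
  apply: mulr_ge0; [do 2!apply: exprn_ge0; exact: ler0n | exact: ler0n].
exists C; first exact: C0.
move=> p g N l p_pr Nt Np l0.
have p1 : 1 <= p%:R :> R by rewrite ler1n prime_gt0.
apply: (@bootstrap_bound R p g p_pr (fun N => C * p%:R ^+ 12 * N%:R ^+ 71) N) => //.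
- by move=> n nN n16; apply: pow96_base => //; rewrite exprn_ege1.
- move=> k n kn _; rewrite mulrCA ler_wpM2l //.
    by rewrite mulr_ge0 ?exprn_ge0 ?ler0n ?ltW.
  by apply: pow96_scale.
move=> n V n16 nN V0 hV _.
have n0 : (0 < n)%N by exact: leq_trans n16.
have np : (n ^ 2 <= p)%N by apply: leq_trans Np; rewrite leq_exp2r.
have [hE _] := hD p g n p_pr (leq_trans nN Nt) n0.
have hE' : (energy (progression g n))%:R ^+ 24 <= D%:R * n%:R ^+ 71 :> R.
  by rewrite -!natrX -natrM ler_nat hE.
apply: le_trans (energy_step_small (exprn_ge0 4 (ler0n R 128)) (ler0n R p) (ler0n R n) V0 hV hE') _.
by rewrite ler_wpM2r ?exprn_ge0 ?ler0n // ler_wpM2r ?exprn_ge0 ?ler0n.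
Qed.

Lemma geomsum_bound (R : realType) : exists2 C : R, 0 < C &
  forall (p : nat) (g : {unit 'F_p}) (N : nat) (l : 'F_p), prime p -> (N <= #[g]%g)%N ->
  l != 0 -> modulus (geomsum g R l N) ^+ 96 <= C * p%:R ^+ 23 * N%:R ^+ 49.
Proof.
have [D hD] := energy_progression_le.
have [C1 [C10 C16C1 C1D]] : exists C : R,
    [/\ 0 < C, 16 ^+ 47 <= C & (128 ^+ 4) ^+ 12 * D%:R <= C].
  apply: exists_common_bound; first by rewrite exprn_gt0.
  apply: mulr_ge0; [do 2!apply: exprn_ge0; exact: ler0n | exact: ler0n].
have [C [C0 C1C CDC]] : exists C : R, [/\ 0 < C, C1 <= C & 512 ^+ 24 * D%:R <= C].
  apply: exists_common_bound; first exact: C10.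
  apply: mulr_ge0; [apply: exprn_ge0; exact: ler0n | exact: ler0n].
have C16C := le_trans C16C1 C1C; have C1D' := le_trans C1D C1C.
exists C; first exact: C0.
move=> p g N l p_pr Nt l0.
have p1 : 1 <= p%:R :> R by rewrite ler1n prime_gt0.
apply: (@bootstrap_bound R p g p_pr (fun N => C * p%:R ^+ 23 * N%:R ^+ 49) N) => //.
- by move=> n nN n16; apply: pow96_base => //; rewrite exprn_ege1.
- move=> k n kn _; rewrite mulrCA ler_wpM2l //.
    by rewrite mulr_ge0 ?exprn_ge0 ?ler0n ?ltW.
  by apply: pow96_scale.
move=> n V n16 nN V0 hV1 hV2.
have n0 : (0 < n)%N by exact: leq_trans n16.
have [hE1 hE2] := hD p g n p_pr (leq_trans nN Nt) n0.
(* The induction passes through lengths on both sides of the square root of [p], so both energy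
   bounds occur. *)
have [np|/ltnW pn] := leqP (n ^ 2) p.
  have hE' : (energy (progression g n))%:R ^+ 24 <= D%:R * n%:R ^+ 71 :> R.
    by rewrite -!natrX -natrM ler_nat hE1.
  apply: le_trans (energy_step_small (exprn_ge0 4 (ler0n R 128)) (ler0n R p) (ler0n R n)
    V0 hV1 hE') _.
  (* This amounts to [n ^ 22 <= p ^ 11]. *)
  have pn12 : p%:R ^+ 12 * n%:R ^+ 71 <= p%:R ^+ 23 * n%:R ^+ 49 :> R.
    have -> : p%:R ^+ 23 = p%:R ^+ 12 * p%:R ^+ 11 :> R by rewrite -exprD.
    have -> : n%:R ^+ 71 = n%:R ^+ 22 * n%:R ^+ 49 :> R by rewrite -exprD.
    rewrite -[leRHS]mulrA ler_wpM2l ?exprn_ge0 ?ler0n // ler_wpM2r ?exprn_ge0 ?ler0n //.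
    by rewrite -!natrX ler_nat -[22%N]/(2 * 11)%N expnM leq_exp2r.
  rewrite -[leLHS]mulrA -[leRHS]mulrA ler_pM ?mulr_ge0 ?exprn_ge0 ?ler0n //.
have hE' : p%:R * (energy (progression g n))%:R ^+ 24 <= D%:R * n%:R ^+ 73 :> R.
  by rewrite -!natrX -!natrM ler_nat hE2.
have p0 : 0 < p%:R :> R by rewrite ltr0n prime_gt0.
have n0' : 0 < n%:R :> R by rewrite ltr0n.
apply: le_trans (energy_step_large (ler0n R 512) p0 n0' V0 hV2 hE') _.
by rewrite ler_wpM2r ?exprn_ge0 ?ler0n // ler_wpM2r ?exprn_ge0 ?ler0n.
Qed.

(** * Real exponents and the three ranges *)

Lemma powR_exprn (R : realType) (x a : R) n : (x `^ a) ^+ n = x `^ (a * n%:R).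
Proof. by rewrite -powR_mulrn ?powR_ge0 // powRrM. Qed.

Lemma powR_96th (R : realType) (x a : R) k : 0 <= x -> a * 96%:R = k%:R ->
  (x `^ a) ^+ 96 = x ^+ k.
Proof. by move=> x0 e; rewrite powR_exprn e powR_mulrn. Qed.

Lemma exists_powR_ge (R : realType) (C eps : R) : 0 < C -> 0 < eps ->
  exists n0 : nat, forall N : nat, (n0 <= N)%N -> C <= (N%:R `^ eps) ^+ 96.
Proof.
move=> C0 eps0; have e96 : 0 < eps * 96%:R by rewrite mulr_gt0 ?ltr0n.
pose y := C `^ (eps * 96%:R)^-1.
exists (Num.truncn y).+1 => N yN; rewrite powR_exprn.
have yN' : y <= N%:R by rewrite ltW // -truncn_lt_nat ?powR_ge0.
have -> : C = y `^ (eps * 96%:R).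
  by rewrite /y -powRrM mulVf ?gt_eqF // powRr1 // ltW.
by apply: ge0_ler_powR; rewrite ?nnegrE ?powR_ge0 ?ler0n ?(ltW e96).
Qed.

Lemma sqr_le_of_le_sqrt (R : realType) (N t : nat) :
  N%:R <= t%:R `^ (1 / 2) :> R -> (N ^ 2 <= t)%N.
Proof.
move=> h; rewrite -(ler_nat R) natrX.
have -> : t%:R = (t%:R `^ (1 / 2)) ^+ 2 :> R.
  by rewrite powR_exprn divfK ?pnatr_eq0 // powRr1 // ler0n.
by rewrite lerXn2r ?nnegrE ?powR_ge0 ?ler0n.
Qed.

Lemma lt_sqr_of_sqrt_lt (R : realType) (N t : nat) :
  t%:R `^ (1 / 2) < N%:R :> R -> (t < N ^ 2)%N.
Proof.
move=> h; rewrite -(ltr_nat R) natrX.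
have -> : t%:R = (t%:R `^ (1 / 2)) ^+ 2 :> R.
  by rewrite powR_exprn divfK ?pnatr_eq0 // powRr1 // ler0n.
by rewrite ltr_pXn2r ?nnegrE ?powR_ge0 ?ler0n.
Qed.

Lemma intr_Fp_neq0 (p : nat) (lambda : int) : prime p -> coprimez lambda p%:Z ->
  lambda%:~R != 0 :> 'F_p.
Proof.
move=> p_pr; apply: contraTneq => /eqP.
rewrite -(dvdz_pcharf (pchar_Fp p_pr)) => pl.
have p_gcd : (p%:Z %| gcdz lambda p%:Z)%Z by rewrite dvdz_gcd pl dvdzz.
apply/negP => /eqP e; move: p_gcd; rewrite e dvdzE /= dvdn1.
by case: p p_pr {pl e} => [|[|?]].
Qed.
Theorem theorem2 (R : realType) :
  forall eps : R, 0 < eps ->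
  exists N0 : nat,
  forall (p : nat) (g : {unit 'F_p}) (t N : nat),
    prime p -> #[g]%g = t -> (0 < N)%N -> (N <= t)%N -> (N0 <= N)%N ->
  forall lambda : int, coprimez lambda p%:Z ->
  [/\ N%:R <= t%:R `^ (1 / 2) :> R ->
        `|expsum R g lambda N|
          <= (p%:R `^ (1 / 8) * N%:R `^ (71 / 96 + eps))%:C%C,
      t%:R `^ (1 / 2) < N%:R :> R -> N%:R <= p%:R `^ (1 / 2) :> R ->
        `|expsum R g lambda N|
          <= (p%:R `^ (1 / 8) * t%:R `^ (- (1 / 96))
              * N%:R `^ (73 / 96 + eps))%:C%C
    & p%:R `^ (1 / 2) < N%:R :> R -> (N < t)%N ->
        `|expsum R g lambda N|
          <= (p%:R `^ (1 / 4) * t%:R `^ (- (1 / 96))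
              * N%:R `^ (49 / 96 + eps))%:C%C].
Proof.
move=> eps eps0.
have [C1 C10 hC1] := geomsum_bound_small R; have [C2 C20 hC2] := geomsum_bound R.
have [n1 hn1] := exists_powR_ge C10 eps0; have [n2 hn2] := exists_powR_ge C20 eps0.
exists (maxn n1 n2) => p g t N p_pr gt N0 Nt; rewrite geq_max => /andP[n1N n2N] lambda colp.
have l0 := intr_Fp_neq0 p_pr colp.
have Ng : (N <= #[g]%g)%N by rewrite gt.
have tp : (t <= p)%N by rewrite -gt order_le_prime.
have Npos : 0 < N%:R :> R by rewrite ltr0n.
have tpos : 0 < t%:R :> R by rewrite ltr0n (leq_trans N0).
have ppos : 0 < p%:R :> R by rewrite ltr0n prime_gt0.
have {}hC1 : (N ^ 2 <= p)%N -> modulus (geomsum g R lambda%:~R N) ^+ 96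
    <= (N%:R `^ eps) ^+ 96 * p%:R ^+ 12 * N%:R ^+ 71.
  move=> Np; apply: le_trans (hC1 p g N _ p_pr Ng Np l0) _.
  by do 2!(apply: ler_wpM2r; first by rewrite exprn_ge0 ?ler0n); exact: hn1.
have {}hC2 : modulus (geomsum g R lambda%:~R N) ^+ 96
    <= (N%:R `^ eps) ^+ 96 * p%:R ^+ 23 * N%:R ^+ 49.
  apply: le_trans (hC2 p g N _ p_pr Ng l0) _.
  by do 2!(apply: ler_wpM2r; first by rewrite exprn_ge0 ?ler0n); exact: hn2.
rewrite expsumE modulusE !lecR; set V := modulus _ in hC1 hC2 *.
have V0 : 0 <= V by apply: modulus_ge0.
have Neps a : N%:R `^ (a + eps) = N%:R `^ a * N%:R `^ eps :> R.
  by rewrite powRD // (gt_eqF Npos) implybT.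
(* In 96th powers every exponent becomes integral, apart from the one with [eps]. *)
have root96 (X : R) : 0 <= X -> V ^+ 96 <= X ^+ 96 -> V <= X.
  by move=> X0; rewrite ler_pXn2r ?nnegrE.
have tinv : (t%:R `^ (- (1 / 96))) ^+ 96 = t%:R^-1 :> R.
  by rewrite powR_exprn mulNr divfK ?pnatr_eq0 // powR_inv1 // ltW.
have q a : a / 96 * 96%:R = a :> R by rewrite divfK // pnatr_eq0.
split.
- move=> /sqr_le_of_le_sqrt N2t; apply: root96.
    by rewrite !mulr_ge0 ?powR_ge0.
  apply: le_trans (hC1 (leq_trans N2t tp)) _; rewrite Neps !exprMn.
  have pE : 1 / 8 * 96%:R = 12%:R :> R by field.
  rewrite (powR_96th (ltW ppos) pE).
  rewrite (powR_96th (ltW Npos) (q 71%:R)).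
  set e := (N%:R `^ eps) ^+ 96; move: e (p%:R ^+ 12) (N%:R ^+ 71) => z x y.
  by have -> : x * (y * z) = z * x * y by ring.
- move=> /lt_sqr_of_sqrt_lt tN2 /sqr_le_of_le_sqrt N2p; apply: root96.
    by rewrite !mulr_ge0 ?powR_ge0.
  apply: le_trans (hC1 N2p) _; rewrite Neps !exprMn tinv.
  have pE : 1 / 8 * 96%:R = 12%:R :> R by field.
  rewrite (powR_96th (ltW ppos) pE).
  rewrite (powR_96th (ltW Npos) (q 73%:R)).
  set e := (N%:R `^ eps) ^+ 96; have e0 : 0 <= e by rewrite exprn_ge0 ?powR_ge0.
  (* The range condition [t < N ^ 2] trades two powers of [N] for [1 / t]. *)
  have h : N%:R ^+ 71 <= t%:R^-1 * N%:R ^+ 73 :> R.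
    rewrite mulrC ler_pdivlMr // -[73%N]/(71 + 2)%N exprD ler_wpM2l ?exprn_ge0 ?(ltW Npos) //.
    by rewrite -natrX ler_nat ltnW.
  have -> : p%:R ^+ 12 * t%:R^-1 * (N%:R ^+ 73 * e)
      = e * p%:R ^+ 12 * (t%:R^-1 * N%:R ^+ 73).
    by move: (p%:R ^+ 12) (N%:R ^+ 73) (t%:R^-1) => x y z; ring.
  by apply: ler_wpM2l h; rewrite mulr_ge0 // exprn_ge0 ?(ltW ppos).
move=> _ _; apply: root96; first by rewrite !mulr_ge0 ?powR_ge0.
apply: le_trans hC2 _; rewrite Neps !exprMn tinv.
have pE : 1 / 4 * 96%:R = 24%:R :> R by field.
  rewrite (powR_96th (ltW ppos) pE).
rewrite (powR_96th (ltW Npos) (q 49%:R)).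
set e := (N%:R `^ eps) ^+ 96; have e0 : 0 <= e by rewrite exprn_ge0 ?powR_ge0.
(* Here [t <= p] trades one power of [p] for [1 / t]. *)
have h : p%:R ^+ 23 <= p%:R ^+ 24 * t%:R^-1 :> R.
  rewrite ler_pdivlMr // -[24%N]/(23 + 1)%N exprD ler_wpM2l ?exprn_ge0 ?(ltW ppos) //.
  by rewrite expr1 ler_nat.
have -> : p%:R ^+ 24 * t%:R^-1 * (N%:R ^+ 49 * e)
    = e * (p%:R ^+ 24 * t%:R^-1) * N%:R ^+ 49.
  by move: (p%:R ^+ 24) (N%:R ^+ 49) (t%:R^-1) => x y z; ring.
apply: ler_wpM2r; first by rewrite exprn_ge0 ?(ltW Npos).
exact: (ler_wpM2l e0).
Qed.
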